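(* For all $n\geqslant 2$, the involution length of $\mathrm{PU}(n,1)$ is at most $8$. That is, every element of $\mathrm{PU}(n,1)$ is a product of at most $8$ involutions of $\mathrm{PU}(n,1)$.
   Context: $\mathrm{U}(n,1)\subset \mathrm{GL}(n+1,\mathbb{C})$ is the unitary group of a Hermitian form of signature $(n,1)$ on $\mathbb{C}^{n+1}$, and $\mathrm{PU}(n,1)$ is its image in $\mathrm{PGL}(n+1,\mathbb{C})$. An involution is an element of order $2$ of $\mathrm{PU}(n,1)$. The involution length of a group is the smallest $k\in\mathbb{N}$ such that every element of the group is a product of at most $k$ involutions of the group. *)

(* Defs.v *)
From HB Require Import structures.
From mathcomp Require Import all_boot all_order all_algebra complex.
From mathcomp Require Import boolp reals.

Set Implicit Arguments.
Unset Strict Implicit.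
Unset Printing Implicit Defensive.

Import GRing.Theory Num.Theory.
Local Open Scope ring_scope.
Local Open Scope quotient_scope.

(* The library's {'GL_n[R]} requires R to be finite. *)
Section GeneralLinear.
Variables (F : fieldType) (n : nat).

Record GL := MkGL { GL_mx :> 'M[F]_n; _ : GL_mx \in unitmx }.

HB.instance Definition _ := [isSub for GL_mx].
HB.instance Definition _ := [Choice of GL by <:].

Lemma GL_unit (g : GL) : (g : 'M_n) \in unitmx. Proof. exact: valP. Qed.

Definition GL_one : GL := MkGL (unitmx1 F n).
Lemma GL_inv_unit (g : GL) : invmx g \in unitmx.
Proof. by rewrite unitmx_inv GL_unit. Qed.
Definition GL_inv (g : GL) : GL := MkGL (GL_inv_unit g).
Lemma GL_mul_unit (g h : GL) : (g : 'M_n) *m h \in unitmx.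
Proof. by rewrite unitmx_mul !GL_unit. Qed.
Definition GL_mul (g h : GL) : GL := MkGL (GL_mul_unit g h).

Fact GL_mulA : associative GL_mul.
Proof. by move=> g h k; apply: val_inj; rewrite /= mulmxA. Qed.
Fact GL_mul1 : left_id GL_one GL_mul.
Proof. by move=> g; apply: val_inj; rewrite /= mul1mx. Qed.
Fact GL_mulr1 : right_id GL_one GL_mul.
Proof. by move=> g; apply: val_inj; rewrite /= mulmx1. Qed.
Fact GL_mulV : left_inverse GL_one GL_inv GL_mul.
Proof. by move=> g; apply: val_inj; rewrite /= mulVmx ?GL_unit. Qed.
Fact GL_mulrV : right_inverse GL_one GL_inv GL_mul.
Proof. by move=> g; apply: val_inj; rewrite /= mulmxV ?GL_unit. Qed.

HB.instance Definition _ :=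
  isGroup.Build GL GL_mulA GL_mul1 GL_mulr1 GL_mulV GL_mulrV.

Lemma GL_mxM (g h : GL) : (g * h)%g = (g : 'M_n) *m h :> 'M_n.
Proof. by []. Qed.
Lemma GL_mxV (g : GL) : (g^-1)%g = invmx g :> 'M_n. Proof. by []. Qed.
Lemma GL_mx1 : (1%g : GL) = 1%:M :> 'M_n. Proof. by []. Qed.

(* Congruence modulo the subgroup of scalar matrices. *)
Definition PGL_eq (g h : GL) := is_scalar_mx (g^-1 * h : GL)%g.

Lemma PGL_eqP (g h : GL) :
  reflect (exists a : F, (h : 'M_n) = a *: (g : 'M_n)) (PGL_eq g h).
Proof.
apply: (iffP is_scalar_mxP) => -[a Ea]; exists a.
  rewrite -mul_mx_scalar -Ea GL_mxM GL_mxV mulmxA.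
  by rewrite mulmxV ?GL_unit // mul1mx.
by rewrite GL_mxM GL_mxV Ea -scalemxAr mulVmx ?GL_unit // scalemx1.
Qed.

Fact PGL_eq_refl : reflexive PGL_eq.
Proof. by move=> g; apply/PGL_eqP; exists 1; rewrite scale1r. Qed.

Fact PGL_eq_symW (g h : GL) : PGL_eq g h -> PGL_eq h g.
Proof.
rewrite /PGL_eq => /is_scalar_mxP[a Ea]; apply/is_scalar_mxP; exists a^-1.
have -> : (h^-1 * g = (g^-1 * h)^-1)%g by rewrite invgM invgK.
by rewrite GL_mxV Ea invmx_scalar.
Qed.

Fact PGL_eq_sym : symmetric PGL_eq.
Proof. by move=> g h; apply/idP/idP; apply: PGL_eq_symW. Qed.

Fact PGL_eq_trans : transitive PGL_eq.
Proof.
move=> h g k /PGL_eqP[a Ea] /PGL_eqP[b Eb]; apply/PGL_eqP; exists (b * a).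
by rewrite Eb Ea scalerA.
Qed.

Canonical PGL_equiv := EquivRel PGL_eq PGL_eq_refl PGL_eq_sym PGL_eq_trans.

Definition PGL := {eq_quot PGL_eq}.
HB.instance Definition _ := Choice.on PGL.
HB.instance Definition _ := EqQuotient.on PGL.

Lemma PGL_piP (g h : GL) :
  reflect (exists a : F, (h : 'M_n) = a *: (g : 'M_n))
          (\pi_PGL g == \pi_PGL h).
Proof. by rewrite eqmodE; apply: PGL_eqP. Qed.

Lemma PGL_pi_mul (g g' h h' : GL) : \pi_PGL g = \pi_PGL g' ->
  \pi_PGL h = \pi_PGL h' -> \pi_PGL (g * h)%g = \pi_PGL (g' * h')%g.
Proof.
move=> /eqP/PGL_piP[a Ea] /eqP/PGL_piP[b Eb]; apply/eqP/PGL_piP.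
by exists (a * b); rewrite !GL_mxM Ea Eb -scalemxAl -scalemxAr scalerA.
Qed.

Lemma PGL_pi_inv (g g' : GL) : \pi_PGL g = \pi_PGL g' ->
  \pi_PGL g^-1%g = \pi_PGL g'^-1%g.
Proof.
move=> /eqP/PGL_piP[a Ea]; apply/eqP/PGL_piP; exists a^-1.
by rewrite !GL_mxV Ea invmxZ // -Ea GL_unit.
Qed.

Definition PGL_mul (x y : PGL) : PGL := \pi_PGL (repr x * repr y)%g.
Definition PGL_inv (x : PGL) : PGL := \pi_PGL (repr x)^-1%g.
Definition PGL_one : PGL := \pi_PGL 1%g.

Lemma PGL_mulE (g h : GL) :
  PGL_mul (\pi_PGL g) (\pi_PGL h) = \pi_PGL (g * h)%g.
Proof. by apply: PGL_pi_mul; rewrite reprK. Qed.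

Lemma PGL_invE (g : GL) : PGL_inv (\pi_PGL g) = \pi_PGL g^-1%g.
Proof. by apply: PGL_pi_inv; rewrite reprK. Qed.

Fact PGL_mulA : associative PGL_mul.
Proof.
elim/quotW=> g; elim/quotW=> h; elim/quotW=> k.
by rewrite (PGL_mulE g h) (PGL_mulE h k) !PGL_mulE mulgA.
Qed.
Fact PGL_mul1 : left_id PGL_one PGL_mul.
Proof. by elim/quotW=> g; rewrite PGL_mulE mul1g. Qed.
Fact PGL_mulr1 : right_id PGL_one PGL_mul.
Proof. by elim/quotW=> g; rewrite PGL_mulE mulg1. Qed.
Fact PGL_mulV : left_inverse PGL_one PGL_inv PGL_mul.
Proof. by elim/quotW=> g; rewrite PGL_invE PGL_mulE mulVg. Qed.
Fact PGL_mulrV : right_inverse PGL_one PGL_inv PGL_mul.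
Proof. by elim/quotW=> g; rewrite PGL_invE PGL_mulE mulgV. Qed.

HB.instance Definition _ :=
  isGroup.Build PGL PGL_mulA PGL_mul1 PGL_mulr1 PGL_mulV PGL_mulrV.

Definition PGL_pi (g : GL) : PGL := \pi_PGL g.

Lemma PGL_piM (g h : GL) : PGL_pi (g * h)%g = (PGL_pi g * PGL_pi h)%g.
Proof. by rewrite /PGL_pi -PGL_mulE. Qed.
Lemma PGL_piV (g : GL) : PGL_pi g^-1%g = (PGL_pi g)^-1%g.
Proof. by rewrite /PGL_pi -PGL_invE. Qed.
Lemma PGL_pi1 : PGL_pi 1%g = 1%g. Proof. by []. Qed.
Lemma PGL_pi_eqP (g h : GL) :
  reflect (exists a : F, (h : 'M_n) = a *: (g : 'M_n)) (PGL_pi g == PGL_pi h).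
Proof. exact: PGL_piP. Qed.

End GeneralLinear.

(* Used with C := R[i] for R : realType, i.e. the field of complex numbers. *)
Section ProjectiveUnitary.
Variables (C : numClosedFieldType) (m : nat).
Variable f : {hermitian_sym 'cV[C]_m for Num.conj}.

(* A non-degenerate form has signature (p, q) when it admits an orthogonal basis
   with p vectors of positive and q vectors of negative square; in C, 0 < z and
   z < 0 entail that z is real. *)
Definition has_signature (p q : nat) : Prop :=
  exists (P : p.-tuple 'cV[C]_m) (N : q.-tuple 'cV[C]_m),
    [/\ basis_of fullv (P ++ N), pairwise_orthogonal f (P ++ N),
        {in P, forall u, 0 < f u u} & {in N, forall u, f u u < 0}].

Definition U_pred : {pred GL C m} :=
  [pred g | `[< isometry f f (mulmx (GL_mx g)) >]].

Lemma U_predP (g : GL C m) :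
  reflect (forall u v, f (GL_mx g *m u) (GL_mx g *m v) = f u v) (g \in U_pred).
Proof. exact: asboolP. Qed.

Fact U_group_closed : group_closed U_pred.
Proof.
split=> [|g h /U_predP Ug /U_predP Uh]; apply/U_predP => u v.
  by rewrite GL_mx1 !mul1mx.
rewrite GL_mxM GL_mxV -!mulmxA Ug -[in RHS](mulKVmx (GL_unit h) u).
by rewrite -[in RHS](mulKVmx (GL_unit h) v) Uh.
Qed.

Definition PU_pred : {pred PGL C m} :=
  [pred x | `[< exists2 g, g \in U_pred & x = PGL_pi g >]].

Lemma PU_predP (x : PGL C m) :
  reflect (exists2 g, g \in U_pred & x = PGL_pi g) (x \in PU_pred).
Proof. exact: asboolP. Qed.

Fact PU_group_closed : group_closed PU_pred.
Proof.
split=> [|x y /PU_predP[g Ug ->] /PU_predP[h Uh ->]]; apply/PU_predP.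
  by exists 1%g; rewrite ?PGL_pi1 //; case: U_group_closed.
exists (g / h)%g; last by rewrite PGL_piM PGL_piV.
by case: U_group_closed => _; apply.
Qed.

Record PU := MkPU { PU_val :> PGL C m; _ : PU_val \in PU_pred }.

HB.instance Definition _ := [isSub for PU_val].
HB.instance Definition _ := [Choice of PU by <:].
HB.instance Definition _ :=
  SubChoice_isSubGroup.Build (PGL C m) PU_pred PU PU_group_closed.

End ProjectiveUnitary.

Section InvolutionLength.
Variable G : groupType.

Definition involution (x : G) : bool := ((x != 1) && (x ^+ 2 == 1))%g.

(* The empty product is allowed: the identity is a product of 0 involutions. *)
Definition product_of_involutions (k : nat) (x : G) : Prop :=
  exists s : seq G,
    [/\ (size s <= k)%N, all involution s & x = (\prod_(y <- s) y)%g].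

Definition is_involution_length (k : nat) : Prop :=
  (forall x, product_of_involutions k x) /\
  (forall j, (forall x, product_of_involutions j x) -> (k <= j)%N).

End InvolutionLength.

(* Main.v *)
Require Import Defs.
From mathcomp Require Import all_boot all_order all_algebra complex.
From mathcomp Require Import boolp reals ring.

(** Work in coordinates where the form is J = diag(-1, 1, ..., 1), and let A
    preserve J.  Write e for the first basis vector, so that e has square -1.

    If x and y have square -1 and the product of x and y is real and
    nonnegative, then x - y has negative square and the reflection in x - y
    exchanges x and y ([timelike_transitive]).  In complex hyperbolic space this
    is the symmetry about the midpoint of two points.  Up to a phase mu it
    therefore takes a single reflection S to bring A e back to e: S A e = mu e.

    The remaining freedom is the choice of the representative t A of the
    projective class, |t| = 1.  A product of linear involutions has determinant
    1 or -1, so t has to be chosen such that det (t A) ^ 2 = 1.  The solutions t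
    of this equation form a coset of the group of all 2 (n + 1)-th roots of
    unity, and there are enough of them for Re (t mu) < 0 to hold as well
    ([unit_scaling]).  This sign condition is what makes it possible to go from
    e to a e, where a = t mu, through two intermediate vectors of the plane
    spanned by e and another basis vector, with consecutive products
    nonnegative.  Thus a product P of three reflections maps e to a e
    ([timelike_rotation]).

    Now h = P^-1 S (t A) fixes the vector e itself, hence acts on its orthogonal
    complement as a unitary matrix whose determinant has square 1.  By the
    spectral theorem this matrix may be taken to be diag(d_0, ..., d_(n-1)).
    With the partial products q_k = d_0 ... d_(k-1) one has
    d_k = q_(k+1) / q_k, and q_0 and q_n are equal to their inverses.  Thus
    diag(d) is the product of
      diag(q_1, 1/q_1, q_3, 1/q_3, ...) and diag(1, q_2, 1/q_2, q_4, ...),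
    whose entries pair off into inverses; since
      diag(q, 1/q) = [0, q; 1/q, 0] [0, 1; 1, 0],
    each of them is a product of two unitary involutions
    ([diag_involution_product]).  So t A = S P h is a product of 1 + 3 + 4 = 8
    involutions, and a factor that becomes trivial in the projective group can
    be dropped. *)

Set Implicit Arguments.
Unset Strict Implicit.
Unset Printing Implicit Defensive.

Import Order.TTheory GRing.Theory Num.Theory.
Local Open Scope ring_scope.
Local Open Scope sesquilinear_scope.

(** * Isometries of a Hermitian Gram matrix and their involutions *)

Lemma trmxCM (C : numClosedFieldType) p q r
    (A : 'M[C]_(p, q)) (B : 'M[C]_(q, r)) :
  (A *m B)^t* = B^t* *m A^t*.
Proof. by rewrite trmx_mul map_mxM. Qed.

(** Linear in the first argument and conjugate-linear in the second, as the
    sesquilinear forms of the library are; hence the order of x and y on the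
    right. *)
Definition gram (C : numClosedFieldType) m (J : 'M[C]_m) (x y : 'cV[C]_m) : C :=
  (y^t* *m J *m x) 0 0.

Lemma gram_delta (C : numClosedFieldType) m (J : 'M[C]_m) i j :
  gram J (delta_mx j 0) (delta_mx i 0) = J i j.
Proof. by rewrite /gram trmx_delta map_delta_mx -rowE -colE !mxE. Qed.

Section HermitianGram.
Variables (C : numClosedFieldType) (m : nat) (J : 'M[C]_m).

Local Notation dot := (gram J).

Definition preserves (M : 'M[C]_m) := M^t* *m J *m M = J.

Definition gram_involution (S : 'M[C]_m) := preserves S /\ S *m S = 1%:M.

Definition involution_product (k : nat) (M : 'M[C]_m) :=
  exists s : seq 'M[C]_m,
    [/\ (size s <= k)%N, {in s, forall S, gram_involution S}
      & M = \prod_(S <- s) S].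

Lemma gramE x y : y^t* *m J *m x = (dot x y)%:M.
Proof. exact: mx11_scalar. Qed.

Lemma gramDl x x' y : dot (x + x') y = dot x y + dot x' y.
Proof. by rewrite /gram mulmxDr mxE. Qed.

Lemma gramZl a x y : dot (a *: x) y = a * dot x y.
Proof. by rewrite /gram -scalemxAr mxE. Qed.

Lemma gramDr x y y' : dot x (y + y') = dot x y + dot x y'.
Proof. by rewrite /gram linearD /= map_mxD !mulmxDl mxE. Qed.

Lemma gramZr a x y : dot x (a *: y) = a^* * dot x y.
Proof. by rewrite /gram linearZ /= map_mxZ -!scalemxAl mxE. Qed.

Lemma preservesP M :
  preserves M <-> forall x y, dot (M *m x) (M *m y) = dot x y.
Proof.
rewrite /preserves; split=> [hM x y|hM].
  by rewrite /gram trmxCM -[in RHS]hM !mulmxA.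
apply/matrixP=> i j; have := hM (delta_mx j 0) (delta_mx i 0).
rewrite gram_delta => <-; rewrite -[LHS]gram_delta /gram trmxCM.
by rewrite !mulmxA.
Qed.

Lemma preserves1 : preserves 1%:M.
Proof. by apply/preservesP => x y; rewrite !mul1mx. Qed.

Lemma preservesM A B : preserves A -> preserves B -> preserves (A *m B).
Proof.
move=> /preservesP hA /preservesP hB; apply/preservesP => x y.
by rewrite -!mulmxA hA hB.
Qed.

Lemma preservesV A : A \in unitmx -> preserves A -> preserves (invmx A).
Proof.
move=> uA /preservesP hA; apply/preservesP => x y.
by rewrite -hA !mulKVmx.
Qed.

Lemma preservesZ a A : `|a| = 1 -> preserves A -> preserves (a *: A).
Proof.
move=> a1 /preservesP hA; apply/preservesP => x y.
by rewrite -!scalemxAl gramZl gramZr hA mulrA -normCK a1 expr1n mul1r.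
Qed.

Lemma gram_involution_product S : gram_involution S -> involution_product 1 S.
Proof.
move=> hS; exists [:: S]; split=> // [A|]; last by rewrite big_seq1.
by rewrite inE => /eqP->.
Qed.

Lemma involution_productM k l A B :
  involution_product k A -> involution_product l B ->
  involution_product (k + l) (A *m B).
Proof.
move=> [s [sk hs ->]] [s' [sl hs' ->]]; exists (s ++ s'); split.
- by rewrite size_cat leq_add.
- by move=> S; rewrite mem_cat => /orP[/hs|/hs'].
- by rewrite mulmxE big_cat.
Qed.

Lemma involution_product_ind (P : 'M[C]_m -> Prop) k A :
  P 1%:M ->
  (forall S B, gram_involution S -> P B -> P (S *m B)) ->
  involution_product k A -> P A.
Proof.
move=> P1 PM [s [_ hs ->]]; elim: s hs => [|S s IHs] hs.
  by rewrite -mulmxE big_nil -idmxE.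
rewrite big_cons -mulmxE; apply: PM; first by apply: hs; rewrite mem_head.
by apply: IHs => S' S's; apply: hs; rewrite inE S's orbT.
Qed.

Lemma involution_product_preserves k A : involution_product k A -> preserves A.
Proof.
apply: (@involution_product_ind preserves) => [|S B [hS _]].
  exact: preserves1.
exact: preservesM.
Qed.

(** The constraint that forces the rescaling of a projective class before it can
    be factored into linear involutions. *)
Lemma involution_product_det k A : involution_product k A -> \det A ^+ 2 = 1.
Proof.
apply: (@involution_product_ind (fun A => \det A ^+ 2 = 1)) => [|S B [_ hS] hB].
  by rewrite det1 expr1n.
by rewrite det_mulmx exprMn hB mulr1 expr2 -det_mulmx hS det1.
Qed.

Hypothesis J_herm : J^t* = J.

Lemma gramC x y : dot y x = (dot x y)^*.
Proof.
rewrite /gram; set A := y^t* *m J *m x.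
have -> : (A 0 0)^* = A^t* 0 0 by rewrite !mxE.
by rewrite /A !trmxCM trmxCK J_herm mulmxA.
Qed.

Definition reflection (u : 'cV[C]_m) : 'M[C]_m :=
  1%:M - (2 / dot u u) *: (u *m (u^t* *m J)).

Lemma reflectionE u x : reflection u *m x = x - (2 * dot x u / dot u u) *: u.
Proof.
rewrite mulmxBl mul1mx -scalemxAl -mulmxA gramE mul_mx_scalar scalerA.
by rewrite mulrAC.
Qed.

Lemma reflection_involution u : dot u u != 0 -> gram_involution (reflection u).
Proof.
move=> u0; split.
  apply/preservesP => x y; rewrite !reflectionE -!scaleNr.
  rewrite !(gramDl, gramDr, gramZl, gramZr) (gramC y u) !rmorphN /=.
  rewrite !rmorphM /= fmorphV /= -!gramC rmorph_nat.
  by field.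
rewrite /reflection; set Q := u *m _.
have QQ : Q *m Q = dot u u *: Q.
  by rewrite /Q -mulmxA [_ *m (u *m _)]mulmxA gramE mul_scalar_mx -scalemxAr.
rewrite mulmxBl mul1mx mulmxBr mulmx1 -scalemxAl -scalemxAr QQ !scalerA.
rewrite -addrA -opprD -scaleNr -scalerDl -scalerDl.
have -> : 2 / dot u u + (2 / dot u u - 2 / dot u u * (2 / dot u u) * dot u u) = 0.
  by field.
by rewrite scale0r subr0.
Qed.

(** For real [dot x y] the two cross terms of the square of [x - y] agree, so
    this square is twice [dot x (x - y)], and the reflection subtracts exactly
    [x - y] from [x]. *)
Lemma reflection_swap x y : dot x x = dot y y -> dot x y \is Num.real ->
  dot (x - y) (x - y) != 0 -> reflection (x - y) *m x = y.
Proof.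
move=> xy_norm xy_real xy0; rewrite reflectionE.
have xyC : dot y x = dot x y by rewrite gramC (CrealP xy_real).
have -> : 2 * dot x (x - y) = dot (x - y) (x - y).
  rewrite -!(scaleN1r y) !(gramDl, gramDr, gramZl, gramZr) rmorphN1 xyC xy_norm.
  by ring.
by rewrite divff // scale1r subKr.
Qed.

End HermitianGram.

(** * Products of involutions in the unitary group *)

Lemma preserves1_unitarymx (C : numClosedFieldType) n (U : 'M[C]_n) :
  preserves 1%:M U <-> U \is unitarymx.
Proof.
rewrite /preserves mulmx1; split=> [/mulmx1C/unitarymxP //|/unitarymxP].
exact: mulmx1C.
Qed.

Definition monomial (C : numClosedFieldType) n (s : 'I_n -> 'I_n)
    (c : 'I_n -> C) : 'M[C]_n :=
  \matrix_(i, j) (c i *+ (j == s i)).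

Lemma monomialM (C : numClosedFieldType) n s c c' : involutive s ->
  monomial s c *m monomial s c' =
  diag_mx (\row_(i < n) (c i * c' (s i) : C)).
Proof.
move=> sK; apply/matrixP=> i j; rewrite !mxE (bigD1 (s i)) //= !mxE eqxx sK.
rewrite big1 => [|k /negPf ksi]; last by rewrite !mxE ksi mul0r.
by rewrite addr0 mulr1n mulrnAr eq_sym.
Qed.

Lemma monomial_involution (C : numClosedFieldType) n s c : involutive s ->
  (forall i : 'I_n, `|c i| = 1 :> C) -> (forall i, c i * c (s i) = 1) ->
  gram_involution 1%:M (monomial s c).
Proof.
move=> sK c1 cs; have MM : monomial s c *m monomial s c = 1%:M.
  rewrite monomialM // -diag_const_mx; congr diag_mx.
  by apply/rowP => i; rewrite !mxE.
split=> //; rewrite /preserves mulmx1 -[RHS]MM; congr (_ *m _).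
apply/matrixP=> i j; rewrite !mxE; have [->|isj] := eqVneq i (s j).
  have cj0 : c j != 0 by rewrite -normr_eq0 c1 oner_eq0.
  by apply: (mulfI cj0); rewrite sK eqxx !mulr1n cs -normCK c1 expr1n.
rewrite mulr0n conjC0; case: eqP => // jsi.
by rewrite jsi sK eqxx in isj.
Qed.

(** The two perfect pairings of a path, up to its ends: [b = false] pairs
    (0, 1), (2, 3), ..., and [b = true] pairs (1, 2), (3, 4), ....  An index left
    alone at an end is fixed. *)
Section Chain.
Variables (C : numClosedFieldType) (n : nat) (b : bool).

Lemma neighbour_subproof (k : 'I_n) :
  ((if odd k (+) b then k.-1 else if k.+1 < n then k.+1 else k) < n)%N.
Proof. by case: ifP => _; [case: k => [[|k]] //= /ltnW|case: ifP]. Qed.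

(** For [b = true] the index 0 is fixed because [0.-1 = 0]. *)
Definition neighbour k := Ordinal (neighbour_subproof k).

Lemma neighbourK : involutive neighbour.
Proof.
move=> k; apply: val_inj; rewrite /=; case kb: (odd k (+) b); last first.
  case: (ltnP k.+1 n) => kn; last by rewrite kb ltnNge kn.
  by rewrite /= addNb kb.
case: k kb => [[|k]] /= kn; first by case: b.
by rewrite addNb => /negbTE->; rewrite kn.
Qed.

Variable d : 'I_n -> C.
Definition prefix_prod k := \prod_(i < n | (i < k)%N) d i.

(** Within a pair (k, k + 1) of [neighbour] the two coefficients are the product
    of the first k + 1 entries of [d] and its inverse.  The same formula is used
    at an unpaired end, where it gives the empty product or the full one. *)
Definition chain_coef (k : 'I_n) :=
  if odd k (+) b then (prefix_prod k)^-1 else prefix_prod k.+1.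

Hypothesis d1 : forall i, `|d i| = 1.
Hypothesis d_prod : (\prod_i d i) ^+ 2 = 1.

Lemma norm_prefix_prod k : `|prefix_prod k| = 1.
Proof. by rewrite normr_prod big1. Qed.

Lemma prefix_prod_neq0 k : prefix_prod k != 0.
Proof. by rewrite -normr_eq0 norm_prefix_prod oner_eq0. Qed.

Lemma prefix_prod0 : prefix_prod 0 = 1.
Proof. exact: big_pred0. Qed.

Lemma prefix_prodn : prefix_prod n ^+ 2 = 1.
Proof.
by rewrite -d_prod; congr (_ ^+ 2); apply: eq_bigl => i; rewrite ltn_ord.
Qed.

(** [d_prod] enters at the last index when it is unpaired: its coefficient is
    the full product, which has to be its own inverse. *)
Lemma chain_coef_involution : gram_involution 1%:M (monomial neighbour chain_coef).
Proof.
apply: monomial_involution => [|i|i].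
- exact: neighbourK.
- by rewrite /chain_coef; case: ifP; rewrite ?normfV norm_prefix_prod ?invr1.
rewrite /chain_coef /=; case ib: (odd i (+) b).
  case: i ib => [[|i]] /= _.
    by move=> ->; rewrite prefix_prod0 invr1 mulr1.
  by rewrite addNb => /negbTE->; rewrite mulVf ?prefix_prod_neq0.
case: (ltnP i.+1 n) => lt_in /=; first by rewrite addNb ib mulfV ?prefix_prod_neq0.
rewrite ib; have -> : i.+1 = n by apply/eqP; rewrite eqn_leq ltn_ord.
by rewrite -expr2 prefix_prodn.
Qed.

End Chain.

Lemma swap_involution (C : numClosedFieldType) n b :
  gram_involution 1%:M (monomial (@neighbour n b) (fun=> 1 : C)).
Proof.
apply: monomial_involution => [|i|i]; rewrite ?normr1 ?mulr1 //.
exact: neighbourK.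
Qed.

(** Telescoping: the i-th entry is the quotient of two successive partial
    products; one of the two pairings has the numerator as its coefficient at i,
    the other one the inverse of the denominator. *)
Lemma diag_involution_product (C : numClosedFieldType) n (d : 'rV[C]_n) :
  (forall i, `|d 0 i| = 1) -> (\prod_i d 0 i) ^+ 2 = 1 ->
  involution_product 1%:M 4 (diag_mx d).
Proof.
move=> d1 dp; pose M b := monomial (@neighbour n b) (chain_coef b (d 0)).
pose S b := monomial (@neighbour n b) (fun=> 1 : C).
have -> : diag_mx d = (M false *m S false) *m (M true *m S true).
  rewrite !monomialM; try exact: neighbourK.
  rewrite mulmx_diag; congr diag_mx; apply/rowP=> i; rewrite !mxE !mulr1.
  have qS : prefix_prod (d 0) i.+1 = prefix_prod (d 0) i * d 0 i.
    rewrite /prefix_prod (bigD1 i) //= mulrC; congr (_ * _).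
    by apply: eq_bigl => j; rewrite ltnS ltn_neqAle andbC.
  rewrite /chain_coef addbF addbT; case: (odd i) => /=.
    by rewrite qS mulrA mulVf ?mul1r ?prefix_prod_neq0.
  by rewrite qS mulrAC mulfV ?mul1r ?prefix_prod_neq0.
have hM b : involution_product 1%:M 2 (M b *m S b).
  apply: (@involution_productM _ _ _ 1 1); apply: gram_involution_product.
    exact: chain_coef_involution.
  exact: swap_involution.
exact: (@involution_productM _ _ _ 2 2).
Qed.

Lemma involution_product_morph (C : numClosedFieldType) n m (J : 'M[C]_n)
    (J' : 'M[C]_m) (phi : 'M[C]_n -> 'M[C]_m) k A :
  phi 1%:M = 1%:M -> {morph phi : X Y / X *m Y} ->
  (forall X, preserves J X -> preserves J' (phi X)) ->
  involution_product J k A -> involution_product J' k (phi A).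
Proof.
move=> phi1 phiM phiJ [s [sk hs ->]]; exists (map phi s); split.
- by rewrite size_map.
- move=> _ /mapP[S /hs[JS SS] ->]; split; first exact: phiJ.
  by rewrite -phiM SS.
rewrite big_map; elim: s {sk hs} => [|S s IHs].
  by rewrite -!mulmxE !big_nil -!idmxE.
by rewrite !big_cons -!mulmxE phiM IHs.
Qed.

Lemma unitary_involution_product (C : numClosedFieldType) n (U : 'M[C]_n) :
  U \is unitarymx -> \det U ^+ 2 = 1 -> involution_product 1%:M 4 U.
Proof.
move=> uU dU; have nU : U \is normalmx.
  by apply/normalmxP; rewrite (unitarymxP uU) (mulmx1C (unitarymxP uU)).
have uP := spectral_unitarymx U; set P := spectralmx U in uP.
set d := spectral_diag U; have eU : U = invmx P *m diag_mx d *m P.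
  exact: orthomx_spectralP.
have PK : P \in unitmx by apply: unitarymx_unit.
have ud : diag_mx d \is unitarymx.
  have -> : diag_mx d = P *m U *m invmx P.
    by rewrite eU -!mulmxA mulKVmx // mulmxV // mulmx1.
  by rewrite invmx_unitary // !mul_unitarymx ?trmxC_unitary.
have d1 i : `|d 0 i| = 1.
  apply/eqP; rewrite -sqrp_eq1 // normCK.
  have /unitarymxP/matrixP/(_ i i) := ud.
  rewrite !mxE (bigD1 i) //= big1 => [|j ji]; last first.
    by rewrite !mxE eq_sym (negPf ji) mulr0n mul0r.
  by rewrite !mxE eqxx addr0 !mulr1n => ->.
rewrite eU.
apply: (@involution_product_morph _ _ _ 1%:M _ (fun X => invmx P *m X *m P)).
- by rewrite mulmx1 mulVmx.
- by move=> X Y; rewrite -!mulmxA; congr (_ *m (_ *m _)); rewrite mulKVmx.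
- move=> X /preserves1_unitarymx uX; apply/preserves1_unitarymx.
  by rewrite invmx_unitary // !mul_unitarymx ?trmxC_unitary.
apply: diag_involution_product => //; rewrite -det_diag -dU eU !det_mulmx det_inv.
by congr (_ ^+ 2); rewrite mulrAC mulVf ?mul1r // -unitfE -unitmxE.
Qed.

(** * The group preserving the form of signature (n, 1) *)

Section Lorentz.
Variables (C : numClosedFieldType) (n : nat).

Definition lorentz : 'M[C]_(1 + n) := block_mx (-1)%:M 0 0 1%:M.
Local Notation J := lorentz.
Local Notation dot := (gram J).

Definition timelike : 'cV[C]_(1 + n) := col_mx 1%:M 0.

Lemma lorentz_herm : J^t* = J.
Proof.
rewrite /J tr_block_mx map_block_mx.
by rewrite !tr_scalar_mx !map_scalar_mx rmorphN1 rmorph1 !trmx0 !map_mx0.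
Qed.

Lemma lorentz_sqr : J *m J = 1%:M.
Proof.
rewrite /J mulmx_block !(mulmx0, mul0mx, mulmx1, addr0, add0r).
by rewrite -scalar_mxM mulrNN mulr1 scalar_mx_block.
Qed.

Lemma lorentzE (i j : 'I_(1 + n)) :
  J i j = (-1) ^+ (i == 0) *+ (i == j).
Proof.
case: (split_ordP i) => i' ->; case: (split_ordP j) => j' ->.
all: rewrite ?(block_mxEul, block_mxEur, block_mxEdl, block_mxEdr) !mxE.
all: rewrite ?ord1 ?eq_lshift ?eq_rshift ?eq_lrshift ?eq_rlshift //.
Qed.

Lemma gram_lorentz (a b : 'M[C]_1) (u v : 'cV[C]_n) :
  dot (col_mx a u) (col_mx b v) = - (a 0 0 * (b 0 0)^*) + gram 1%:M u v.
Proof.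
rewrite /gram /J tr_col_mx map_row_mx mul_row_block mul_row_col.
rewrite !mulmx0 addr0 add0r mul_mx_scalar scaleN1r mulNmx mulmx1.
rewrite !mxE; congr (- _ + _).
by rewrite big_ord1 !mxE mulrC.
Qed.

Lemma gram_timelike : dot timelike timelike = -1.
Proof. by rewrite gram_lorentz /gram mulmx0 !mxE conjC1 mulr1 addr0. Qed.

(** The square of [x - y] is [- (2 + 2 * dot x y)], so nonnegativity of the
    product guarantees that the reflection in [x - y] exists. *)
Lemma timelike_transitive x y : dot x x = -1 -> dot y y = -1 -> 0 <= dot x y ->
  exists2 S, gram_involution J S & S *m x = y.
Proof.
move=> xx yy xy; have dxy : dot (x - y) (x - y) != 0.
  have yx : dot y x = dot x y.
    by rewrite (gramC lorentz_herm) (CrealP (ger0_real xy)).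
  rewrite -(scaleN1r y) !(gramDl, gramDr, gramZl, gramZr) rmorphN1 yx xx yy.
  rewrite (_ : _ + _ = - (2 + 2 * dot x y)); last by ring.
  by rewrite oppr_eq0 gt_eqF // ltr_wpDr ?ltr0n // mulr_ge0.
exists (reflection J (x - y)).
  exact: reflection_involution lorentz_herm _ dxy.
by rewrite reflection_swap ?lorentz_herm ?xx ?ger0_real.
Qed.

(** The phase of [dot w timelike] can be absorbed into [mu], after which
    [timelike_transitive] applies. *)
Lemma timelike_align w : dot w w = -1 ->
  exists mu S, [/\ `|mu| = 1, gram_involution J S & S *m w = mu *: timelike].
Proof.
move=> ww; pose g := dot w timelike.
have [mu mu1 gmu] : exists2 mu : C, `|mu| = 1 & 0 <= mu^* * g.
  have [->|g0] := eqVneq g 0; first by exists 1; rewrite ?normr1 ?mulr0.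
  exists (g / `|g|); first by rewrite normf_div normr_id divff ?normr_eq0.
  rewrite rmorphM /= fmorphV /= (CrealP (normr_real _)) mulrAC mulr_ge0 //.
    by rewrite mulrC -normCK exprn_ge0.
  by rewrite invr_ge0.
have [||S hS Sw] := @timelike_transitive w (mu *: timelike) ww.
- by rewrite gramZl gramZr gram_timelike mulrA -normCK mu1 expr1n mul1r.
- by rewrite gramZr.
by exists mu, S.
Qed.

(** In the plane of [timelike] and an orthogonal unit vector, write (x, y) for
    coordinates.  The path is (1, 0), (-X, Y), (-aX, eta), (a, 0) with X, Y > 0
    and X^2 - Y^2 = 1.  The first and last products are X.  The middle one is
    eta Y - a X^2; requiring it to be a nonnegative real rho gives
    eta = (rho + a X^2) / Y, and the third vector has square -1 if and only if
    |rho + a X^2| = Y^2 = X^2 - 1, that is,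
      2 X^2 (1 + rho c) = 1 - rho^2   where c = Re a.
    For rho = - 2 / c, which is positive as c < 0, the left factor 1 + rho c is
    -1 and the solution is X^2 = (4 / c^2 - 1) / 2, greater than 1 because
    c^2 <= 1. *)
Lemma timelike_rotation a : (0 < n)%N -> `|a| = 1 -> 'Re a < 0 ->
  exists2 P, involution_product J 3 P & P *m timelike = a *: timelike.
Proof.
move=> n0 a1 a_neg; pose e : 'cV[C]_n := delta_mx (Ordinal n0) 0.
pose z (x y : C) : 'cV[C]_(1 + n) := col_mx x%:M (y *: e).
have zz x y x' y' : dot (z x y) (z x' y') = y * y'^* - x * x'^*.
  rewrite gram_lorentz gramZl gramZr gram_delta !mxE !eqxx !mulr1n addrC.
  by rewrite mulr1.
have z0 x : z x 0 = x *: timelike.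
  by rewrite /z /timelike scale_col_mx scalemx1 scale0r scaler0.
set c := 'Re a in a_neg *; have c_real : c \is Num.real by exact: Creal_Re.
have aa : a * a^* = 1 by rewrite -normCK a1 expr1n.
have ac : a^* = 2 * c - a by rewrite /c ReE; field.
have c0 : c != 0 by rewrite lt_eqF.
have c_le1 : c ^+ 2 <= 1.
  have := normC2_Re_Im a; rewrite a1 expr1n -/c => ->.
  by rewrite lerDl real_exprn_even_ge0 // Creal_Im.
pose X2 := (4 / c ^+ 2 - 1) / 2; pose Y2 := X2 - 1.
have c2_gt0 : 0 < c ^+ 2 by rewrite real_exprn_even_gt0 // c0 orbT.
have Y2_gt0 : 0 < Y2.
  have -> : Y2 = (1 + 3 * (1 - c ^+ 2)) / c ^+ 2 / 2 by rewrite /Y2 /X2; field.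
  by rewrite !divr_gt0 // ltr_wpDr // mulr_ge0 // subr_ge0.
have X2_gt0 : 0 < X2 by rewrite (lt_trans Y2_gt0) // /Y2 gtrBl.
have [X X_gt0 XE] : exists2 X : C, 0 < X & X ^+ 2 = X2.
  by exists (sqrtC X2); rewrite ?sqrtC_gt0 ?sqrtCK.
have [Y Y_gt0 YE] : exists2 Y : C, 0 < Y & Y ^+ 2 = Y2.
  by exists (sqrtC Y2); rewrite ?sqrtC_gt0 ?sqrtCK.
have Xc : X^* = X by rewrite (CrealP (gtr0_real X_gt0)).
have Yc : Y^* = Y by rewrite (CrealP (gtr0_real Y_gt0)).
have Y0 : Y != 0 by rewrite gt_eqF.
pose rho : C := - (2 / c).
have rho_ge0 : 0 <= rho by rewrite oppr_ge0 mulr_ge0_le0 // invr_le0 ltW.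
have rhoc : rho^* = rho by rewrite (CrealP (ger0_real rho_ge0)).
pose eta := (rho + a * X ^+ 2) / Y.
have eta_norm : eta * eta^* = Y ^+ 2.
  rewrite /eta rmorphM /= fmorphV /= rmorphD /= rmorphM /= rmorphXn /= Xc Yc rhoc.
  have key : (rho + a * X ^+ 2) * (rho + a^* * X ^+ 2) = Y ^+ 2 * Y ^+ 2.
    rewrite (_ : _ * _ = rho ^+ 2 + rho * X ^+ 2 * (a + a^*)
                          + (a * a^*) * (X ^+ 2) ^+ 2); last by ring.
    by rewrite aa ac XE YE /Y2 /X2 /rho; field.
  by rewrite mulrACA key; field.
have [||S1 hS1 S1e] := @timelike_transitive timelike (z (- X) Y) gram_timelike.
- by rewrite zz rmorphN /= Xc Yc mulrNN -!expr2 XE YE /Y2; ring.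
- by rewrite -[timelike]scale1r -z0 zz rmorphN /= Xc mul0r mul1r sub0r opprK ltW.
have zeta : dot (z (- (a * X)) eta) (z (- (a * X)) eta) = -1.
  rewrite zz eta_norm rmorphN /= rmorphM /= Xc mulrNN mulrACA aa mul1r -expr2.
  by rewrite XE YE /Y2; ring.
have [||S2 hS2 S2e] := @timelike_transitive (z (- X) Y) (z (- (a * X)) eta) _ zeta.
- by rewrite zz rmorphN /= Xc Yc mulrNN -!expr2 XE YE /Y2; ring.
- rewrite zz rmorphN /= !rmorphM /= fmorphV /= rmorphD /= rmorphM /= rmorphXn /=.
  rewrite Xc Yc rhoc (_ : _ - _ = rho) //; by field.
have [||S3 hS3 S3e] := @timelike_transitive (z (- (a * X)) eta) (a *: timelike) zeta.
- by rewrite gramZl gramZr gram_timelike mulrA aa mul1r.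
- rewrite -z0 zz conjC0 mulr0 sub0r mulNr opprK mulrAC aa mul1r ltW //.
exists (S3 *m (S2 *m S1)); last by rewrite -!mulmxA S1e S2e S3e.
apply: (@involution_productM _ _ _ 1 2); first exact: gram_involution_product.
by apply: (@involution_productM _ _ _ 1 1); apply: gram_involution_product.
Qed.

(** Such an [h] is block diagonal, because the orthogonal complement of
    [timelike] is invariant too; its second block is unitary. *)
Lemma timelike_stabilizer h : preserves J h -> h *m timelike = timelike ->
  \det h ^+ 2 = 1 -> involution_product J 4 h.
Proof.
move=> hJ he dh; pose U := drsubmx h.
pose phi (X : 'M[C]_n) : 'M[C]_(1 + n) := block_mx 1%:M 0 0 X.
have [ha hc] : ulsubmx h = 1%:M /\ dlsubmx h = 0.
  apply: eq_col_mx; rewrite -[RHS]he -[h in RHS]submxK /timelike mul_block_col.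
  by rewrite !mulmx1 !mulmx0 !addr0.
have hE : h = block_mx 1%:M (ursubmx h) 0 U by rewrite -{1}[h]submxK ha hc.
have [hU uU] : h = phi U /\ preserves 1%:M U.
  move: hJ; rewrite /preserves /J {1 2}hE tr_block_mx map_block_mx !mulmx_block.
  rewrite !(trmx0, map_mx0, mulmx0, mul0mx, mulmx1, mul1mx, addr0, add0r) trmx1.
  rewrite map_mx1 !mul1mx => /eq_block_mx[_ b0 _ dd].
  have b0' : ursubmx h = 0.
    by apply/eqP; rewrite -oppr_eq0 -b0 mul_scalar_mx scaleN1r.
  split; first by rewrite {1}hE b0'.
  by rewrite b0' trmx0 map_mx0 mulmx0 ?mul0mx add0r in dd.
rewrite hU; apply: (@involution_product_morph _ _ _ 1%:M _ phi).
- exact/esym/scalar_mx_block.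
- by move=> X Y; rewrite /phi mulmx_block !(mulmx0, mul0mx, mulmx1, addr0, add0r).
- move=> X; rewrite /preserves mulmx1 => XX.
  rewrite /phi /J tr_block_mx map_block_mx !mulmx_block.
  rewrite !(trmx0, map_mx0, mulmx0, mul0mx, mulmx1, mul1mx, addr0, add0r).
  by rewrite trmx1 map_mx1 !mul1mx XX.
apply: unitary_involution_product; first exact/preserves1_unitarymx.
by rewrite -dh hU det_ublock det1 mul1r.
Qed.

(** Both [t] and [- t] solve the equation, so only Re (t kappa) = 0 has to be
    avoided.  Multiplying a solution by a root [zeta] of [zeta ^+ n.+1 = -1]
    gives another one, and if t kappa is purely imaginary then zeta t kappa is
    not, provided that [zeta] is not real.  The principal root of -1 is not
    real: it could be neither negative, by its choice, nor nonnegative, since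
    its power is negative. *)
Lemma unit_scaling (kappa delta : C) : (0 < n)%N -> kappa != 0 -> `|delta| = 1 ->
  exists t, [/\ `|t| = 1, (t ^+ n.+1 * delta) ^+ 2 = 1 & 'Re (t * kappa) < 0].
Proof.
move=> n0 k0 d1.
have d0 : delta != 0 by rewrite -normr_eq0 d1 oner_eq0.
have norm_root z : `|z ^+ n.+1| = 1 -> `|z| = 1.
  by move/eqP; rewrite normrX pexpr_eq1 // => /eqP.
suff [t [t1 tE tk]] : exists t,
    [/\ `|t| = 1, (t ^+ n.+1 * delta) ^+ 2 = 1 & 'Re (t * kappa) != 0].
  have [tk_lt|tk_ge] := boolP ('Re (t * kappa) < 0); first by exists t.
  exists (- t); rewrite normrN; split=> //.
    by rewrite exprNn -mulrA exprMn sqrr_sign mul1r.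
  rewrite mulNr raddfN /= oppr_lt0 lt_def tk.
  by rewrite real_leNgt ?real0 // Creal_Re.
pose t0 := n.+1.-root (delta^-1); pose zeta : C := n.+1.-root (-1).
have t0E : t0 ^+ n.+1 * delta = 1 by rewrite rootCK // mulVf.
have t01 : `|t0| = 1 by apply: norm_root; rewrite rootCK // normfV d1 invr1.
have [t0k|t0k] := eqVneq ('Re (t0 * kappa)) 0; last first.
  by exists t0; rewrite t0E expr1n.
have zE : zeta ^+ n.+1 = -1 by rewrite rootCK.
have z1 : `|zeta| = 1 by apply: norm_root; rewrite zE normrN1.
exists (zeta * t0); split; first by rewrite normrM z1 t01 mul1r.
  by rewrite [(zeta * t0) ^+ _]exprMn zE -mulrA t0E mulr1 sqrrN expr1n.
have z_im : 'Im zeta != 0.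
  apply/negP => /eqP/Creal_ImP z_real.
  have z_ge0 : 0 <= zeta by rewrite real_leNgt ?real0 // rootC_lt0.
  by rewrite rootC_ge0 // ler0N1 in z_ge0.
rewrite -mulrA ReM t0k mulr0 sub0r oppr_eq0 mulf_neq0 //.
apply/eqP => i0; have := Crect (t0 * kappa); rewrite t0k i0 mulr0 addr0 => /eqP.
by rewrite mulf_eq0 (negPf k0) orbF -normr_eq0 t01 oner_eq0.
Qed.

(** The matrix form of the theorem; the factor [t] disappears in the projective
    group. *)
Theorem lorentz_involution_product M : (0 < n)%N -> preserves J M ->
  exists2 t, t != 0 & involution_product J 8 (t *: M).
Proof.
move=> n0 MJ.
have w_norm : dot (M *m timelike) (M *m timelike) = -1.
  by rewrite (proj1 (preservesP J M) MJ) gram_timelike.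
have [mu [S [mu1 hS SM]]] := timelike_align w_norm.
have dM : `|\det M| = 1.
  have J0 : \det J != 0.
    by rewrite det_ublock det_scalar1 det1 mulr1 oppr_eq0 oner_eq0.
  have : \det (M^t* *m J *m M) = \det J by rewrite MJ.
  rewrite !det_mulmx det_map_mx det_tr mulrAC => /(canRL (mulfK J0)).
  rewrite divff // mulrC -normCK => /eqP.
  by rewrite sqrp_eq1 // => /eqP.
have mu0 : mu != 0 by rewrite -normr_eq0 mu1 oner_eq0.
have [t [t1 tM tmu]] := unit_scaling n0 mu0 dM.
exists t; first by rewrite -normr_eq0 t1 oner_eq0.
have [|P hP Pe] := timelike_rotation n0 _ tmu; first by rewrite normrM t1 mu1 mulr1.
have PJ := involution_product_preserves hP.
have dP := involution_product_det hP.
have uP : P \in unitmx.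
  rewrite unitmxE unitfE; apply/eqP => d0; move: dP; rewrite d0 expr0n => /eqP.
  by rewrite eq_sym oner_eq0.
have [SJ SS] := hS.
pose h := invmx P *m (S *m (t *: M)).
have -> : t *: M = S *m (P *m h) by rewrite mulKVmx // mulmxA SS mul1mx.
apply: (@involution_productM _ _ _ 1 7); first exact: gram_involution_product.
apply: (@involution_productM _ _ _ 3 4) => //.
apply: timelike_stabilizer.
- apply: preservesM; first exact: preservesV uP PJ.
  by apply: preservesM => //; apply: preservesZ.
- by rewrite -!mulmxA -scalemxAl -scalemxAr SM scalerA -Pe mulKmx.
rewrite !det_mulmx detZ det_inv !exprMn exprVn dP invr1 mul1r -exprMn tM mulr1.
by rewrite (involution_product_det (gram_involution_product hS)).
Qed.

End Lorentz.

(** * From matrices to the projective group *)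

(** Factors equal to 1 are not involutions and have to be removed. *)
Lemma product_of_involutions_sq1 (G : groupType) k (s : seq G) :
  (size s <= k)%N -> all (fun x => x ^+ 2 == 1)%g s ->
  product_of_involutions k (\prod_(x <- s) x)%g.
Proof.
move=> sk hs; exists [seq x <- s | x != 1]%g; split.
- by rewrite (leq_trans _ sk) // size_filter count_size.
- apply/allP => x; rewrite mem_filter => /andP[x1 /(allP hs) x2].
  exact/andP.
rewrite big_filter; elim: s {sk hs} => [|x s IHs]; first by rewrite !big_nil.
by rewrite !big_cons IHs; case: eqP => // ->; rewrite mul1g.
Qed.

Lemma involution_length_exists (G : groupType) k :
  (forall x : G, product_of_involutions k x) ->
  exists2 j, is_involution_length G j & (j <= k)%N.
Proof.
move=> hk; pose P j := `[< forall x : G, product_of_involutions j x >].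
have exP : exists j, P j by exists k; apply/asboolP.
case: (ex_minnP exP) => j /asboolP hj j_min; exists j.
  by split=> // i hi; apply: j_min; apply/asboolP.
by apply: j_min; apply/asboolP.
Qed.

Section Transfer.
Variables (C : numClosedFieldType) (n : nat).
Variable f : {hermitian_sym 'cV[C]_n.+1 for Num.conj}.

Lemma pairwise_orthogonal_nth s i j : pairwise_orthogonal f s ->
  (i < size s)%N -> (j < size s)%N -> i != j -> f s`_i s`_j = 0.
Proof.
move=> /andP[_]; have fC u v : f u v = 0 -> f v u = 0.
  by move=> uv; rewrite hermC uv rmorph0 mulr0.
elim: s i j => [|u s IHs] [|i] [|j] //= /andP[]; rewrite andbT => /allP us ss hi hj ij.
- by apply/eqP/us/mem_nth.
- by apply/fC/eqP/us/mem_nth.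
- exact: IHs.
Qed.

Lemma form_expand (B : 'M[C]_n.+1) x y :
  f (B *m x) (B *m y) = \sum_i \sum_j x j 0 * (y i 0)^* * f (col j B) (col i B).
Proof.
have colE z : B *m z = \sum_j z j 0 *: col j B.
  apply/colP=> k; rewrite !mxE summxE; apply: eq_bigr => j _.
  by rewrite !mxE mulrC.
rewrite !colE linear_sumr; apply: eq_bigr => i _ /=.
rewrite linear_sumlz; apply: eq_bigr => j _ /=.
rewrite linearZl_LR linearZr_LR /=.
by rewrite mulrA.
Qed.

(** The columns of [B] are the vectors of an orthogonal basis, the negative one
    first, divided by the square roots of the absolute values of their squares.
    [B] is invertible because the form J is nondegenerate. *)
Lemma signature_basis : has_signature f n 1 ->
  exists2 B, B \in unitmx & forall x y, f (B *m x) (B *m y) = gram (lorentz C n) x y.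
Proof.
move=> [P [N [_ PN_orth P_pos N_neg]]].
(* The negative vector comes last in [P ++ N]. *)
pose b (i : 'I_(1 + n)) := (P ++ N)`_(if i == 0%N :> nat then n else i.-1).
have sz : size (P ++ N) = n.+1 by rewrite size_cat !size_tuple addn1.
have b_orth i j : i != j -> f (b i) (b j) = 0.
  move=> ij; apply: pairwise_orthogonal_nth => //; rewrite ?sz.
  - by case: i {ij} => [[|i]] //= /ltnW.
  - by case: j {ij} => [[|j]] //= /ltnW.
  case: i j ij => [[|i] hi] [[|j] hj] //=.
  - by move=> _; rewrite gtn_eqF.
  - by move=> _; rewrite ltn_eqF.
have b0 : f (b 0) (b 0) < 0.
  apply: N_neg; rewrite /b /= nth_cat size_tuple ltnn subnn.
  by apply: mem_nth; rewrite size_tuple.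
have bS i : i != 0 -> 0 < f (b i) (b i).
  case: i => [[|i] hi] // _; apply: P_pos.
  rewrite /b /= nth_cat size_tuple (hi : (i < n)%N).
  by apply: mem_nth; rewrite size_tuple.
pose r i := (sqrtC `|f (b i) (b i)|)^-1.
pose B : 'M[C]_n.+1 := \matrix_(i, j) (r j *: b j) i 0.
have colB j : col j B = r j *: b j by apply/colP=> i; rewrite !mxE.
have rr i : r i * (r i)^* * `|f (b i) (b i)| = 1.
  rewrite /r geC0_conj ?invr_ge0 ?sqrtC_ge0 // -invfM -expr2 sqrtCK mulVf //.
  by rewrite normr_eq0; have [->|/bS/gt_eqF->//] := eqVneq i 0; rewrite lt_eqF.
have sgnE j : f (b j) (b j) = (-1) ^+ (j == 0) * `|f (b j) (b j)|.
  have [->|j0] := eqVneq j 0; first by rewrite ltr0_norm // mulN1r opprK.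
  by rewrite mul1r gtr0_norm ?bS.
have fB x y : f (B *m x) (B *m y) = gram (lorentz C n) x y.
  rewrite form_expand /gram mxE exchange_big; apply: eq_bigr => j _ /=.
  rewrite mxE mulr_suml; apply: eq_bigr => i _.
  rewrite !colB linearZl_LR linearZr_LR /= lorentzE !mxE.
  rewrite mulrAC -mulrA mulrC; congr (_ * _); rewrite mulrC; congr (_ * _).
  have [->|ij] := eqVneq i j; last by rewrite b_orth 1?eq_sym // !mulr0.
  by rewrite mulrA mulr1n [f _ _]sgnE mulrCA rr mulr1.
exists B => //; rewrite unitmxE unitfE -det_tr; apply/negP => /det0P[v v0 vB].
have Bv : B *m v^T = 0 by apply: trmx_inj; rewrite trmx_mul trmxK vB trmx0.
have Jv : lorentz C n *m v^T = 0.
  apply/colP=> i; have := fB v^T (delta_mx i 0).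
  rewrite Bv linear0l /gram trmx_delta map_delta_mx -rowE -row_mul mxE => <-.
  by rewrite mxE.
case/eqP: v0; apply: trmx_inj; rewrite trmx0.
by rewrite -[v^T]mul1mx -lorentz_sqr -mulmxA Jv mulmx0.
Qed.

Variable B : 'M[C]_n.+1.
Hypothesis uB : B \in unitmx.
Hypothesis fB : forall x y, f (B *m x) (B *m y) = gram (lorentz C n) x y.

Lemma U_pred_preserves (A : GL C n.+1) :
  A \in U_pred f <-> preserves (lorentz C n) (invmx B *m A *m B).
Proof.
split=> [/U_predP hA|/preservesP hA].
  by apply/preservesP => x y; rewrite -!fB -!mulmxA !mulKVmx // hA.
apply/U_predP => u v; rewrite -[u](mulKVmx uB) -[v](mulKVmx uB) !fB -hA -!fB.
by rewrite -!mulmxA !mulKVmx.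
Qed.

Lemma gram_involution_PU S : gram_involution (lorentz C n) S ->
  exists (x : PU f) (A : GL C n.+1),
    [/\ (x ^+ 2 == 1)%g, PU_val x = PGL_pi A & GL_mx A = B *m S *m invmx B].
Proof.
move=> [SJ SS].
have uS : S \in unitmx by case: (mulmx1_unit SS).
have uA : B *m S *m invmx B \in unitmx by rewrite !unitmx_mul uB uS unitmx_inv.
pose A := MkGL uA.
have hA : PGL_pi A \in PU_pred f.
  apply/PU_predP; exists A => //; apply/U_pred_preserves.
  by rewrite /= -!mulmxA mulKmx // mulVmx // mulmx1.
exists (MkPU hA), A; split=> //.
rewrite expgS expg1; apply/eqP/val_inj => /=.
rewrite -PGL_piM; congr PGL_pi; apply: val_inj => /=.
by rewrite !mulmxA mulmxKV // -[X in X *m _]mulmxA SS mulmx1 mulmxV.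
Qed.

Lemma involution_product_PU (s : seq 'M[C]_n.+1) :
  {in s, forall S, gram_involution (lorentz C n) S} ->
  exists (xs : seq (PU f)) (A : GL C n.+1),
    [/\ size xs = size s, all (fun x => x ^+ 2 == 1)%g xs,
        PU_val (\prod_(x <- xs) x)%g = PGL_pi A
      & GL_mx A = B *m (\prod_(S <- s) S) *m invmx B].
Proof.
elim: s => [_|S s IHs hs].
  exists [::], 1%g; split=> //; first by rewrite big_nil.
  by rewrite -mulmxE !big_nil -idmxE mulmx1 mulmxV.
have [|xs [A [sz xs2 xsA AE]]] := IHs.
  by move=> S' S's; apply: hs; rewrite inE S's orbT.
have [|x [A' [x2 xA' A'E]]] := @gram_involution_PU S.
  by apply: hs; rewrite mem_head.
exists (x :: xs), (A' * A)%g; split=> /=; first by rewrite sz.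
- by rewrite x2.
- by rewrite big_cons PGL_piM -xA' -xsA.
by rewrite A'E AE big_cons -!mulmxE !mulmxA mulmxKV.
Qed.

End Transfer.

Theorem theorem2 (R : realType) (n : nat)
    (f : {hermitian_sym 'cV[R[i]]_n.+1 for Num.conj}) :
  (2 <= n)%N -> has_signature f n 1 ->
  (exists2 k : nat, is_involution_length (PU f) k & (k <= 8)%N) /\
  (forall g : PU f, product_of_involutions 8 g).
Proof.
move=> n2 /signature_basis[B uB fB].
suff prod8 : forall g : PU f, product_of_involutions 8 g.
  by split=> //; apply: involution_length_exists.
move=> g; have /PU_predP[A UA gA] := valP g.
have MJ := proj1 (U_pred_preserves uB fB A) UA.
have [t t0 [s [s8 hs sE]]] := lorentz_involution_product (ltnW n2) MJ.
have [xs [D [sz xs2 xsD DE]]] := involution_product_PU uB fB hs.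
have -> : g = (\prod_(x <- xs) x)%g; last first.
  by apply: product_of_involutions_sq1; rewrite ?sz.
apply: val_inj => /=; rewrite gA xsD; apply/eqP/PGL_pi_eqP; exists t.
by rewrite DE -sE -!scalemxAr -!scalemxAl !mulmxA mulmxV // mul1mx mulmxK.
Qed.
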